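(* Let $\mathbb{Z}^2$ act on $\mathbb{R}^2$ by translations along a lattice $\{a\omega_1+b\omega_2:a,b\in\mathbb{Z}\}$ ($\omega_1,\omega_2$ linearly independent). Let $(G,m)$ be a $\mathbb{Z}^2$-gain graph and let $(\tilde G,\tilde p)$ be a $\mathbb{Z}^2$-regular framework in $(\mathbb{R}^2,\|\cdot\|_\infty)$ derived from $(G,m)$. Then $(\tilde G,\tilde p)$ is minimally $\mathbb{Z}^2$-symmetrically (periodically, fixed lattice) infinitesimally rigid if and only if $G$ is $(2,2)$-tight.
   Context: $\|(a_1,a_2)\|_\infty=\max\{|a_1|,|a_2|\}$. For $(x,y)\in\mathbb{R}^2$ let $\kappa(x,y)=(1,0)$ if $|x|>|y|$, $(0,1)$ if $|x|<|y|$, and $(0,0)$ if $|x|=|y|$. For a graph $\tilde G=(\tilde V,\tilde E)$ and $\tilde p:\tilde V\to\mathbb{R}^2$ with distinct endpoints on edges, an infinitesimal motion in $(\mathbb{R}^2,\|\cdot\|_\infty)$ is $u:\tilde V\to\mathbb{R}^2$ with $\kappa(\tilde p(x)-\tilde p(y))\cdot(u(x)-u(y))=0$ for all edges $\{x,y\}$; trivial motions are constant maps (translations). Let $\Gamma$ be a group of isometries. A $\Gamma$-gain graph $(G,m)$ is a finite multigraph $G=(V,E)$ (loops, parallel edges allowed), edges oriented with gains $m(e)\in\Gamma$, parallel edges of equal orientation having distinct gains and loops non-identity gains; $(v_i,v_j;g)$ is an edge from $v_i$ to $v_j$ with gain $g$. The derived graph $\tilde G$ has vertices $\gamma v$ and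 edges $\{\gamma v_i,\gamma gv_j\}$ for each edge $(v_i,v_j;g)$ and $\gamma\in\Gamma$ (an edge orbit); $p:V\to\mathbb{R}^2$ derives $\tilde p(\gamma v)=\gamma p(v)$ (distinct endpoints on edges required). A $\Gamma$-symmetric infinitesimal motion satisfies $u(\gamma x)=\gamma_lu(x)$ ($\gamma_l$ linear part). $\Gamma$-symmetrically infinitesimally rigid: every $\Gamma$-symmetric infinitesimal motion is trivial; minimally: additionally removing any edge orbit destroys this. $\Gamma$-regular: the dimension of the space of $\Gamma$-symmetric infinitesimal motions is minimal among all $\Gamma$-symmetric configurations of $\tilde G$. $(k,l)$-sparse: every subgraph with $|E'|\ge1$ has $|E'|\le k|V'|-l$; $(k,l)$-tight: also $|E|=k|V|-l$.
   Formalization: The vertex set is assumed nonempty, and parallel edges must have distinct gains after being oriented equally (no non-loop pair (v,w;g), (w,v;g^-1)); otherwise two edges share one edge orbit and the equivalence fails. *)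

(* Defs.v *)
From HB Require Import structures.
From mathcomp Require Import all_boot all_order all_algebra.
From mathcomp Require Import classical_sets functions reals.

Set Implicit Arguments.
Unset Strict Implicit.
Unset Printing Implicit Defensive.

Import Order.TTheory GRing.Theory Num.Theory.
Local Open Scope classical_set_scope.
Local Open Scope ring_scope.

(* The group is written additively, so the edge (v_i, v_j; g) has
   src = v_i, dst = v_j, gain = g, and reversing it negates the gain. *)
Record gain_graph (Gamma : zmodType) (V E : finType) := GainGraph {
  src : E -> V;
  dst : E -> V;
  gain : E -> Gamma;
  gain_parallel : forall e f : E,
    src e = src f -> dst e = dst f -> gain e = gain f -> e = f;
  (* Parallel edges are compared after orienting them equally.  Without this
     clause (v_i, v_j; g) and (v_j, v_i; g^-1) would be two edges of the
     multigraph with one and the same edge orbit.  Loops are exempt: two loops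
     at a vertex are only required to have distinct gains. *)
  gain_antiparallel : forall e f : E, src e != dst e ->
    src e = dst f -> dst e = src f -> gain e = - gain f -> e = f;
  gain_loop : forall e : E, src e = dst e -> gain e != 0
}.

Section Sparsity.
Variables (Gamma : zmodType) (V E : finType) (G : gain_graph Gamma V E).

Definition subgraph (V' : {set V}) (E' : {set E}) : Prop :=
  forall e, e \in E' -> (src G e \in V') && (dst G e \in V').

(* The counts are taken in int, as k|V'| - l may be negative. *)
Definition sparse (k l : nat) : Prop :=
  forall (V' : {set V}) (E' : {set E}), subgraph V' E' -> (1 <= #|E'|)%N ->
    #|E'|%:Z <= k%:Z * #|V'|%:Z - l%:Z.

Definition tight (k l : nat) : Prop :=
  sparse k l /\ #|E|%:Z = k%:Z * #|V|%:Z - l%:Z.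

End Sparsity.

Section DerivedGraph.
Variables (Gamma : zmodType) (V E : finType) (G : gain_graph Gamma V E).

(* The pair (g, v) is the derived vertex g v; Gamma acts on the left. *)
Definition vact (g : Gamma) (x : Gamma * V) : Gamma * V := (g + x.1, x.2).

(* Edge sets of the derived graph are encoded as symmetric relations. *)
Definition edge_orbit (e : E) (x y : Gamma * V) : Prop :=
  exists g : Gamma,
    (x = (g, src G e) /\ y = (g + gain G e, dst G e)) \/
    (y = (g, src G e) /\ x = (g + gain G e, dst G e)).

Definition derived_adj (x y : Gamma * V) : Prop :=
  exists e : E, edge_orbit e x y.

Definition derived_adj_minus (e : E) (x y : Gamma * V) : Prop :=
  derived_adj x y /\ ~ edge_orbit e x y.

End DerivedGraph.

Section Frameworks.
Variable R : realType.

Definition kappa (z : 'rV[R]_2) : 'rV[R]_2 :=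
  if `|z 0 1| < `|z 0 0| then delta_mx 0 0
  else if `|z 0 0| < `|z 0 1| then delta_mx 0 1
  else 0.

Definition dot (a b : 'rV[R]_2) : R := \sum_(i < 2) a 0 i * b 0 i.

Definition well_placed (T : Type) (adj : T -> T -> Prop) (p : T -> 'rV[R]_2) :
  Prop := forall x y, adj x y -> p x <> p y.

Definition inf_motion (T : Type) (adj : T -> T -> Prop) (p u : T -> 'rV[R]_2) :
  Prop := forall x y, adj x y -> dot (kappa (p x - p y)) (u x - u y) = 0.

Definition trivial_motion (T : Type) (u : T -> 'rV[R]_2) : Prop :=
  exists c : 'rV[R]_2, forall x, u x = c.

Definition has_dim (W : lmodType R) (S : set W) (n : nat) : Prop :=
  exists b : 'I_n -> W,
    [/\ forall i, S (b i),
        forall a : 'I_n -> R, \sum_i a i *: b i = 0 -> forall i, a i = 0 &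
        forall w, S w -> exists a : 'I_n -> R, w = \sum_i a i *: b i].

Section Symmetric.
Variables (Gamma : zmodType) (V : finType).
Variable act : Gamma -> 'rV[R]_2 -> 'rV[R]_2.

(* Linear part of the affine map [act g]. *)
Definition linear_part (g : Gamma) (x : 'rV[R]_2) : 'rV[R]_2 :=
  act g x - act g 0.

Definition derived_placement (p : V -> 'rV[R]_2) (x : Gamma * V) : 'rV[R]_2 :=
  act x.1 (p x.2).

Definition sym_placement (q : Gamma * V -> 'rV[R]_2) : Prop :=
  forall g x, q (vact g x) = act g (q x).

Definition sym_motions (adj : Gamma * V -> Gamma * V -> Prop)
    (q : Gamma * V -> 'rV[R]_2) : set (Gamma * V -> 'rV[R]_2) :=
  [set u | inf_motion adj q u /\
           forall g x, u (vact g x) = linear_part g (u x)].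

Definition sym_inf_rigid (adj : Gamma * V -> Gamma * V -> Prop)
    (q : Gamma * V -> 'rV[R]_2) : Prop :=
  forall u, sym_motions adj q u -> trivial_motion u.

Definition sym_regular (adj : Gamma * V -> Gamma * V -> Prop)
    (q : Gamma * V -> 'rV[R]_2) : Prop :=
  exists2 n : nat, has_dim (sym_motions adj q) n &
    forall q' : Gamma * V -> 'rV[R]_2,
      sym_placement q' -> well_placed adj q' ->
      forall m : nat, has_dim (sym_motions adj q') m -> (n <= m)%N.

Definition min_sym_inf_rigid (E : finType) (G : gain_graph Gamma V E)
    (q : Gamma * V -> 'rV[R]_2) : Prop :=
  sym_inf_rigid (derived_adj G) q /\
  forall e : E, ~ sym_inf_rigid (derived_adj_minus G e) q.

End Symmetric.

Definition lattice_act (w1 w2 : 'rV[R]_2) (g : int * int) (x : 'rV[R]_2) :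
  'rV[R]_2 := x + (w1 *~ g.1 + w2 *~ g.2).

End Frameworks.

(* Main.v *)
(* In the diagonal coordinates (x + y, x - y), a bar with difference vector
   (a, b) constrains the first components of the velocities if a b > 0 and the
   second ones if a b < 0.  Hence a framework is rigid iff each of the two
   colour classes connects V, and by regularity a tight graph only needs one
   such placement.  It is found by induction on (2,2)-tight graphs whose edges
   carry arbitrary offset vectors in place of lattice gains: a proper tight
   subgraph is placed first and contracted, its placement being absorbed by the
   offsets (generic positions keep parallel edges distinct).  If there is none,
   a vertex of degree 3 is removed by an inverse Henneberg move, which fails
   only for a copy of K4 with balanced offsets.  The other implications are
   rank counts for the rigidity matrix. *)
Require Import Defs.
From HB Require Import structures.
From mathcomp Require Import all_boot all_order all_algebra.
From mathcomp Require Import zify ring lra.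

Set Implicit Arguments.
Unset Strict Implicit.
Unset Printing Implicit Defensive.

Import Order.TTheory GRing.Theory Num.Theory.
Local Open Scope ring_scope.


(** * Points in prescribed open double quadrants of the plane *)

Section Cones.
Variable R : realFieldType.

Lemma upper_bound2 (x y : R) : exists2 z, x < z & y < z.
Proof. by case: (lerP x y) => h; [exists (y + 1)|exists (x + 1)]; lra. Qed.

Lemma lower_bound2 (x y : R) : exists2 z, z < x & z < y.
Proof. by case: (lerP x y) => h; [exists (x - 1)|exists (y - 1)]; lra. Qed.

(** Half-way between the heights of [P] and [Q], beyond both on one side, the horizontal differences
    share a sign and the vertical ones do not. At equal heights the axes swap roles. *)
Lemma opposite_cones_meet (P Q : R * R) : P != Q ->
  exists Z : R * R, 0 < (Z - P).1 * (Z - P).2 /\ (Z - Q).1 * (Z - Q).2 < 0.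
Proof.
case: P Q => [a1 b1] [a2 b2]; rewrite xpair_eqE negb_and /= => neq.
case: (ltgtP b1 b2) => [hb|hb|eb].
- have [a h1 h2] := upper_bound2 a1 a2.
  by exists (a, (b1 + b2) / 2) => /=; split; nra.
- have [a h1 h2] := lower_bound2 a1 a2.
  by exists (a, (b1 + b2) / 2) => /=; split; nra.
subst b2; move: neq; rewrite eqxx orbF neq_lt => /orP[ha|ha].
- by exists ((a1 + a2) / 2, b1 + 1) => /=; split; nra.
by exists ((a1 + a2) / 2, b1 - 1) => /=; split; nra.
Qed.

(** With [P] below and to the left of [Q], suppose first that [W] lies beyond a side of the
    rectangle they span: then [Z] is taken between that side and [W], far out in the other
    direction. If [W] is in the closed rectangle, [Z] goes into the open one, north-west or
    south-east of [W]; both choices fail only when [W] is [P] or [Q]. *)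
Lemma three_cones_meet_pos (P Q W : R * R) :
  0 < (P - Q).1 * (P - Q).2 -> P != W -> Q != W ->
  exists Z : R * R, [/\ 0 < (Z - P).1 * (Z - P).2,
    0 < (Z - Q).1 * (Z - Q).2 & (Z - W).1 * (Z - W).2 < 0].
Proof.
wlog : P Q / P.1 < Q.1 => [wl hPQ hP hQ|].
  case: (ltgtP P.1 Q.1) => h; first exact: wl.
    case: (wl Q P) => //; first by move: hPQ => /=; nra.
    by move=> Z [*]; exists Z; split.
  by move: hPQ => /=; rewrite h subrr mul0r ltxx.
case: P Q W => [a1 b1] [a2 b2] [a3 b3] /= ha hab.
have hb : b1 < b2 by nra.
rewrite !xpair_eqE !negb_and => n1 n2.
case: (ltP a2 a3) => [h|h1].
  have [b hb2 hb3] := upper_bound2 b2 b3.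
  by exists ((a2 + a3) / 2, b) => /=; split; nra.
case: (ltP b2 b3) => [h|h2].
  have [a hb2 hb3] := upper_bound2 a2 a3.
  by exists (a, (b2 + b3) / 2) => /=; split; nra.
case: (ltP a3 a1) => [h|h3].
  have [b hb2 hb3] := lower_bound2 b1 b3.
  by exists ((a1 + a3) / 2, b) => /=; split; nra.
case: (ltP b3 b1) => [h|h4].
  have [a hb2 hb3] := lower_bound2 a1 a3.
  by exists (a, (b1 + b3) / 2) => /=; split; nra.
have [/andP[h5 h6]|h] := boolP ((a1 < a3) && (b3 < b2)).
  by exists ((a1 + a3) / 2, (b3 + b2) / 2) => /=; split; nra.
have [/andP[h5 h6]|h'] := boolP ((a3 < a2) && (b1 < b3)).
  by exists ((a2 + a3) / 2, (b3 + b1) / 2) => /=; split; nra.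
exfalso; move: h h' n1 n2; rewrite !negb_and -!leNgt !neq_lt; lra.
Qed.

(** Negating second coordinates exchanges the two signs. In the inverse Henneberg move [Z] is the
    position of the restored vertex. *)
Lemma three_cones_meet (s : bool) (P Q W : R * R) :
  0 < (-1) ^+ s * ((P - Q).1 * (P - Q).2) -> P != W -> Q != W ->
  exists Z : R * R, [/\ 0 < (-1) ^+ s * ((Z - P).1 * (Z - P).2),
    0 < (-1) ^+ s * ((Z - Q).1 * (Z - Q).2) &
    0 < (-1) ^+ (~~ s) * ((Z - W).1 * (Z - W).2)].
Proof.
case: P Q W => [a1 b1] [a2 b2] [a3 b3]; case: s => /=; rewrite ?expr0 ?expr1 => h.
  move=> n1 n2.
  have [||| [a b] [/= h1 h2 h3]] :=
    @three_cones_meet_pos (a1, - b1) (a2, - b2) (a3, - b3).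
  - by move: h => /=; lra.
  - by move: n1; rewrite !xpair_eqE eqr_opp.
  - by move: n2; rewrite !xpair_eqE eqr_opp.
  by exists (a, - b); split => /=; lra.
move=> n1 n2; have [| Z [/= h1 h2 h3]] := three_cones_meet_pos _ n1 n2.
  by move: h => /=; lra.
by exists Z; split => /=; lra.
Qed.

End Cones.


(** * Properties valid for all sufficiently small positive parameters *)

Section SmallParameter.
Variable R : realFieldType.

Definition small_pos (P : R -> Prop) : Prop :=
  exists2 t0, 0 < t0 & forall t, 0 < t < t0 -> P t.

Lemma small_posI (P Q : R -> Prop) :
  small_pos P -> small_pos Q -> small_pos (fun t => P t /\ Q t).
Proof.
move=> [t0 t0_gt0 Pt0] [t1 t1_gt0 Qt1]; exists (Num.min t0 t1).
  by rewrite lt_min t0_gt0.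
move=> t; rewrite lt_min => /and3P[t_gt0 lt0 lt1].
by split; [apply: Pt0|apply: Qt1]; rewrite t_gt0.
Qed.

Lemma small_pos_all (T : eqType) (s : seq T) (P : T -> R -> Prop) :
  {in s, forall x, small_pos (P x)} ->
  small_pos (fun t => {in s, forall x, P x t}).
Proof.
elim: s => [|x s IHs] Ps; first by exists 1; rewrite ?ltr01.
have [|t0 t0_gt0 Pt0] := @small_posI (P x) (fun t => {in s, forall x, P x t})
    (Ps x (mem_head _ _)).
  by apply: IHs => y sy; apply: Ps; rewrite inE sy orbT.
exists t0 => // t /Pt0[Pxt Pst] y; rewrite inE => /predU1P[->//|]; exact: Pst.
Qed.

Lemma small_pos_ex (P : R -> Prop) : small_pos P -> exists t, P t.
Proof. by move=> [t0 h P0]; exists (t0 / 2); apply: P0; lra. Qed.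

Lemma small_pos_sign (c r : R) : c != 0 ->
  small_pos (fun t => ((0 < c + t * r) = (0 < c)) /\ ((c + t * r < 0) = (c < 0))).
Proof.
move=> c0; have r1 : 0 < `|r| + 1 by rewrite ltr_wpDl.
(* The [+ 1] keeps the denominator positive when [r = 0]. *)
exists (`|c| / (`|r| + 1)); first by rewrite divr_gt0 ?normr_gt0.
move=> t /andP[t0]; rewrite ltr_pdivlMr // => tc.
have tr : `|t * r| < `|c|.
  by rewrite normrM (gtr0_norm t0); apply: le_lt_trans tc; rewrite mulrDr; lra.
move: tr; rewrite ltr_norml; have [c_lt0|c_gt0|e] := ltgtP c 0.
- by rewrite ltr0_norm // => /andP[h1 h2]; split; apply/idP/idP; lra.
- by rewrite gtr0_norm // => /andP[h1 h2]; split; apply/idP/idP; lra.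
by rewrite e eqxx in c0.
Qed.

Lemma small_pos_neq0 (c r : R) : r != 0 -> small_pos (fun t => c + t * r != 0).
Proof.
move=> r0; have [->|c0] := eqVneq c 0.
  by exists 1; rewrite ?ltr01 // => t /andP[t0 _]; rewrite add0r mulf_neq0 // gt_eqF.
have [t0 h H] := small_pos_sign r c0; exists t0 => // t /H [].
by move: c0; rewrite !neq_lt => + -> ->.
Qed.

End SmallParameter.

Lemma pair_ext (A B : Type) (u v : A * B) : u.1 = v.1 -> u.2 = v.2 -> u = v.
Proof. by case: u v => [? ?] [? ?] /= -> ->. Qed.

(** * Darts with offsets and two-coloured placements *)

Section Darts.
Variables (R : realFieldType) (V : finType).

(* The dart [(x, y, d)] asks for the colour of [p x - p y - d]; every edge
   contributes a dart in each direction, which explains the factors in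
   [tight_darts]. *)
Definition dart : Type := (V * V * (R * R))%type.
HB.instance Definition _ := Equality.on dart.

Implicit Types (e f : dart) (D : seq dart) (S T : {set V}) (p : V -> R * R).

Definition rdart e : dart := (e.1.2, e.1.1, - e.2).

Definition disp p e : R * R := p e.1.1 - p e.1.2 - e.2.

(* [disp p e] is in diagonal coordinates; [false] is the colour of the bars
   whose larger component is the first one. *)
Definition coloured (s : bool) p e : bool :=
  0 < (-1) ^+ s * ((disp p e).1 * (disp p e).2).

Definition inside T e : bool := (e.1.1 \in T) && (e.1.2 \in T).

(** The second clause says that each colour class connects [S]. It is phrased through real functions
    because components of velocities will be substituted for [f]. *)
Definition bicoloured p S D : Prop :=
  {in D, forall e, exists s, coloured s p e} /\
  forall (s : bool) (f : V -> R),
    {in D, forall e, coloured s p e -> f e.1.1 = f e.1.2} ->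
    {in S &, forall x y, f x = f y}.

Record tight_darts S D : Prop := TightDarts {
  td_uniq : uniq D;
  td_sym : {in D, forall e, rdart e \in D};
  td_inside : {in D, forall e, inside S e};
  td_sparse : forall T, T != set0 -> (count (inside T) D + 4 <= 4 * #|T|)%N;
  td_size : (size D + 4 = 4 * #|S|)%N
}.

Lemma rdartK : involutive rdart.
Proof. by case=> [[x y] d]; rewrite /rdart /= opprK. Qed.

Lemma coloured_rdart s p e : coloured s p (rdart e) = coloured s p e.
Proof.
rewrite /coloured; congr (0 < _ * _).
by case: e => [[x y] [a b]]; rewrite /disp /=; ring.
Qed.

Lemma colouredP p e :
  reflect (exists s, coloured s p e) ((disp p e).1 * (disp p e).2 != 0).
Proof.
rewrite /coloured; move: (_ * _) => z; apply: (iffP idP) => [|[s]].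
  rewrite neq_lt => /orP[h|h]; [exists true|exists false] => /=.
    by rewrite expr1 mulN1r oppr_gt0.
  by rewrite expr0 mul1r.
by apply: contraTneq => ->; rewrite mulr0 ltxx.
Qed.

Lemma coloured_uniq s p e : coloured s p e -> coloured (~~ s) p e = false.
Proof.
rewrite /coloured; set z := (_.1 * _).
by case: s; rewrite /= ?expr0 ?expr1 => h; apply: negbTE; rewrite -leNgt; lra.
Qed.

(** Shift the first coordinates by [t] times an injective function [r]. For small positive [t] no
    colour changes, since the products are nonzero, and every forbidden difference is avoided, since
    its first coordinate moves with nonzero slope. *)
Lemma bicoloured_generic p S D (B : seq (R * R)) : bicoloured p S D ->
  exists2 p', bicoloured p' S D &
    forall x y d, x != y -> d \in B -> p' x - p' y != d.
Proof.
move=> [pD pS]; pose r (x : V) : R := (enum_rank x)%:R.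
pose q t x := ((p x).1 + t * r x, (p x).2).
have r_inj x y : x != y -> r x - r y != 0.
  apply: contra; rewrite subr_eq0 eqr_nat => /eqP h.
  by apply/eqP/enum_rank_inj/val_inj.
have H1 : small_pos (fun t => {in D, forall e s,
    coloured s (q t) e = coloured s p e}).
  apply: small_pos_all => e De.
  have /colouredP := pD _ De; rewrite mulf_eq0 negb_or => /andP[z1 z2].
  have [t0 t0_gt0 Ht] := small_pos_sign (r e.1.1 - r e.1.2) z1.
  exists t0 => // t /Ht [h1 h2] s; rewrite /coloured.
  have -> : (disp (q t) e).1 = (disp p e).1 + t * (r e.1.1 - r e.1.2).
    by rewrite /disp /q /=; ring.
  have -> : (disp (q t) e).2 = (disp p e).2 by [].
  move: (_ + _) h1 h2 => w; move: ((disp p e).2) z2 => b.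
  case: (ltgtP b 0) => // b0 _ h1 h2; case: s; rewrite ?expr0 ?expr1 ?mul1r ?mulN1r.
  - by rewrite !oppr_gt0 !nmulr_llt0.
  - by rewrite !nmulr_lgt0.
  - by rewrite !oppr_gt0 !pmulr_llt0.
  - by rewrite !pmulr_lgt0.
have H2 : small_pos (fun t => {in enum V, forall x, {in enum V, forall y,
    {in B, forall d, x != y -> q t x - q t y != d}}}).
  apply: small_pos_all => x _; apply: small_pos_all => y _.
  apply: small_pos_all => d _; have [->|xy] := eqVneq x y.
    by exists 1; rewrite ?ltr01.
  have [t0 h0 Ht] := small_pos_neq0 ((p x).1 - (p y).1 - d.1) (r_inj _ _ xy).
  exists t0 => // t /Ht + _; apply: contra => /eqP <- /=; apply/eqP; ring.
have [t [{}H1 {}H2]] := small_pos_ex (small_posI H1 H2).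
exists (q t); last by move=> x y d xy Bd; apply: H2; rewrite ?mem_enum.
split=> [e De|s f Df]; first by have [s] := pD _ De; exists s; rewrite H1.
by apply: pS (s) _ _ => e De pe; apply: Df => //; rewrite H1.
Qed.

Lemma count_predIC (A : Type) (a b : pred A) s :
  count a s = (count (predI a b) s + count (predI a (predC b)) s)%N.
Proof. by elim: s => //= x s ->; case: (a x); case: (b x) => /=; lia. Qed.

(** * Contraction of a tight vertex set to one vertex *)

Section Contraction.
Variables (h : V) (T : {set V}) (q : V -> R * R).

Definition shrink x : V := if x \in T then h else x.
Definition offset x : R * R := if x \in T then q x else 0.
Definition contract e : dart :=
  (shrink e.1.1, shrink e.1.2, e.2 + offset e.1.2 - offset e.1.1).

Lemma contract_rdart e : contract (rdart e) = rdart (contract e).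
Proof. by rewrite /contract /rdart /= !opprD opprK addrAC. Qed.

(** On [T] this is [q] translated by [p h]: darts inside [T] are displaced as under [q], and the
    offsets in [contract] are chosen so that every dart is displaced as its contraction is under
    [p]. *)
Definition expand p x : R * R := p (shrink x) + offset x.

Lemma disp_expand p e : disp (expand p) e = disp p (contract e).
Proof. by rewrite /disp /expand /=; apply: pair_ext => /=; ring. Qed.

Lemma disp_expand_inside p e : inside T e -> disp (expand p) e = disp q e.
Proof.
case/andP => e1 e2; rewrite /disp /expand /shrink /offset e1 e2.
by apply: pair_ext => /=; ring.
Qed.

Hypothesis hT : h \in T.

(** A function constant along one colour is first constant on [T], by [q]. It therefore factors
    through [shrink], and the contracted placement [p] makes it constant on all of [S]. *)
Lemma bicoloured_expand p S D :
  bicoloured q T [seq e <- D | inside T e] ->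
  bicoloured p (h |: (S :\: T)) [seq contract e | e <- D & ~~ inside T e] ->
  bicoloured (expand p) S D.
Proof.
move=> [qD qT] [pD pS]; split=> [e De|s f Df].
  have [eT|eT] := boolP (inside T e).
    have [|s] := qD e; first by rewrite mem_filter eT.
    by exists s; rewrite /coloured disp_expand_inside.
  have [|s] := pD (contract e); first by rewrite map_f // mem_filter eT.
  by exists s; rewrite /coloured disp_expand.
have fT : {in T &, forall x y, f x = f y}.
  apply: (qT s) => e; rewrite mem_filter => /andP[eT De] ec.
  by apply: Df => //; rewrite /coloured disp_expand_inside.
have fsh x : f (shrink x) = f x.
  by rewrite /shrink; case: ifP => // xT; apply: fT.
have shS x : x \in S -> shrink x \in h |: (S :\: T).
  by rewrite /shrink !inE => xS; case: (boolP (x \in T)) => xT;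
    rewrite ?eqxx // xT xS orbT.
move=> x y xS yS; rewrite -(fsh x) -(fsh y); apply: (pS s) (shS _ xS) (shS _ yS).
move=> e' /mapP[e]; rewrite mem_filter => /andP[eT De] -> ec /=.
by rewrite !fsh; apply: Df => //; rewrite /coloured disp_expand.
Qed.

(** Genericity of [q] gives uniqueness: two darts with the same contraction but different ends in
    [T] would satisfy the excluded equation. The count loses exactly the [4 * #|T| - 4] darts inside
    [T], while [#|T|] vertices become one. *)
Lemma tight_darts_contract S D : T \subset S -> tight_darts S D ->
  (count (inside T) D + 4 = 4 * #|T|)%N ->
  (forall x y e f, x != y -> e \in D -> f \in D -> q x - q y != e.2 - f.2) ->
  tight_darts (h |: (S :\: T)) [seq contract e | e <- D & ~~ inside T e].
Proof.
move=> sTS [uD sD iD spD szD] tT gq; split.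
- rewrite map_inj_in_uniq ?filter_uniq // => e f.
  rewrite !mem_filter => /andP[eT De] /andP[fT Df].
  have gqe x y xy := gq x y f e xy Df De; have gqf x y xy := gq x y e f xy De Df.
  move: eT fT gqe gqf; case: e f {De Df} => [[x y] d] [[x' y'] d'] /=.
  rewrite /inside /contract /shrink /offset /= => eT fT gqe gqf [].
  have hN z : z \notin T -> (h = z -> False) by move=> + e; rewrite -e hT.
  have [xT|xT] := boolP (x \in T); have [xT'|xT'] := boolP (x' \in T).
  + move: eT fT; rewrite xT xT' /= => yT yT'; rewrite !ifN // => _ -> ed1 ed2.
    have [exx|xx] := eqVneq x x'; last first.
      have /eqP[] := gqf _ _ xx; by apply: pair_ext => /=; lra.
    rewrite exx in ed1 ed2 *; suff -> : d = d' by [].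
    by apply: pair_ext => /=; lra.
  + by move=> /(hN _ xT').
  + by move=> /esym /(hN _ xT).
  move=> ->; have [yT|yT] := boolP (y \in T); have [yT'|yT'] := boolP (y' \in T).
  + move=> _ ed1 ed2; have [exx|yy] := eqVneq y y'; last first.
      have /eqP[] := gqe _ _ yy; by apply: pair_ext => /=; lra.
    rewrite exx in ed1 ed2 *; suff -> : d = d' by [].
    by apply: pair_ext => /=; lra.
  + by move=> /(hN _ yT').
  + by move=> /esym /(hN _ yT).
  by move=> -> ed1 ed2; suff -> : d = d' by []; apply: pair_ext => /=; lra.
- move=> e' /mapP[e]; rewrite mem_filter => /andP[eT De] ->.
  rewrite -contract_rdart map_f // mem_filter sD // andbT.
  by move: eT; rewrite /inside /= andbC.
- move=> e' /mapP[e]; rewrite mem_filter => /andP[eT De] ->.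
  have /andP[e1 e2] := iD _ De; rewrite /inside /= /shrink !inE.
  by apply/andP; split; case: ifPn => [_|->]; rewrite ?eqxx ?e1 ?e2 ?orbT.
- move=> U U0; pose W := [set x | shrink x \in U].
  have -> : count (inside U) [seq contract e | e <- D & ~~ inside T e] =
      count (predI (inside W) (predC (inside T))) D.
    rewrite count_map count_filter; apply: eq_count => e /=.
    by rewrite /inside /= !inE.
  have countW := count_predIC (inside W) (inside T) D.
  have cardU := cardsID T U.
  (* If [U] contains [h], its preimage [W] contains [T]; otherwise [W] is [U :\: T], which may be
     empty. *)
  have [hU|hU] := boolP (h \in U).
    have WE : W = T :|: (U :\: T).
      by apply/setP=> x; rewrite !inE /shrink; case: ifP => // xT; rewrite hU.
    have W0 : W != set0 by apply/set0Pn; exists h; rewrite WE inE hT.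
    have := spD _ W0; rewrite {2}WE cardsU.
    have -> : T :&: (U :\: T) = set0.
      by apply/setP=> x; rewrite !inE; case: (x \in T).
    have : (0 < #|U :&: T|)%N by apply/card_gt0P; exists h; rewrite inE hU.
    have : count (predI (inside W) (inside T)) D = count (inside T) D.
      apply: eq_count => e; rewrite /= /inside WE !inE.
      by case: (e.1.1 \in T); case: (e.1.2 \in T); rewrite ?andbF.
    rewrite cards0; lia.
  have WE : W = U :\: T.
    by apply/setP=> x; rewrite !inE /shrink; case: ifP => // xT; rewrite (negbTE hU).
  have [W0|W0] := eqVneq W set0.
    move: countW; rewrite W0 -{1}(@eq_count _ pred0) ?count_pred0; last first.
      by move=> e; rewrite /inside !inE.
    have : (0 < #|U|)%N by rewrite card_gt0.
    lia.
  have := spD _ W0; rewrite WE in countW *; lia.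
rewrite size_map size_filter cardsU1 !inE hT /=.
have := count_predC (inside T) D; have := cardsID T S.
rewrite (setIidPr sTS).
have -> : count (predC (inside T)) D = count (fun e => ~~ inside T e) D by [].
lia.
Qed.

End Contraction.
End Darts.


(** * Placing tight graphs so that both colours are connected *)

Section Placement.
Variables (R : realFieldType) (V : finType).
Implicit Types (e f g : dart R V) (D : seq (dart R V)) (S T : {set V}).
Implicit Types (p : V -> R * R).

(** Sparsity on a single vertex leaves room for no dart. *)
Lemma td_loopless S D e : tight_darts S D -> e \in D -> e.1.1 != e.1.2.
Proof.
move=> [_ _ _ spD _] De; apply/eqP=> e12.
have := spD [set e.1.1]; rewrite cards1 -card_gt0 cards1 => /(_ isT).
suff : (0 < count (inside [set e.1.1]) D)%N by lia.
by rewrite -has_count; apply/hasP; exists e; rewrite // /inside -e12 !inE eqxx.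
Qed.

Lemma count_rdart S D (a : pred (dart R V)) : tight_darts S D ->
  count (fun e => a (rdart e)) D = count a D.
Proof.
move=> [uD sD _ _ _]; rewrite -(count_map (@rdart R V)); apply/permP: a.
apply: uniq_perm => //; first by rewrite (map_inj_uniq (can_inj (@rdartK R V))).
move=> e; apply/mapP/idP => [[f /sD fD ->] //|eD].
by exists (rdart e); rewrite ?rdartK ?sD.
Qed.

(** Reversal pairs the darts inside [T]; in the absence of loops the order of the ranks selects one
    of each pair. Evenness turns a strict sparsity bound into room for one more edge. *)
Lemma count_inside_even S D T : tight_darts S D -> ~~ odd (count (inside T) D).
Proof.
move=> tD; rewrite (count_predIC _ (fun e => enum_rank e.1.1 < enum_rank e.1.2)%N).
rewrite -(count_rdart _ tD).
suff -> : count (predI (inside T) (predC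
   (fun e => enum_rank e.1.1 < enum_rank e.1.2)%N)) D =
   count (fun e => predI (inside T)
   (fun e => enum_rank e.1.1 < enum_rank e.1.2)%N (rdart e)) D.
  by rewrite oddD addbb.
apply: eq_in_count => e De; rewrite /inside /= andbC [in RHS]andbC; congr (_ && _).
  rewrite -leqNgt ltn_neqAle; case: eqP => // /val_inj/enum_rank_inj e12.
  by have := td_loopless tD De; rewrite e12 eqxx.
by rewrite andbC.
Qed.

(** Only outgoing darts are counted, so an edge at [x] that is not a loop contributes once. *)
Definition deg D x := count (fun e => e.1.1 == x) D.

Lemma sum_deg S D : {in D, forall e, inside S e} -> (\sum_(x in S) deg D x = size D)%N.
Proof.
elim: D => [|e D IHD] iD /=; first by rewrite big1.
rewrite big_split /= IHD; last by move=> f fD; apply: iD; rewrite inE fD orbT.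
have /andP[eS _] := iD e (mem_head _ _).
by rewrite (bigD1 _ eS) /= eqxx big1 // => x /andP[_ /negbTE]; rewrite eq_sym => ->.
Qed.

Lemma count_delete S D x : tight_darts S D ->
  (count (inside (S :\ x)) D + 2 * deg D x = size D)%N.
Proof.
move=> tD; have degE := count_rdart (fun e => e.1.1 == x) tD.
rewrite mul2n -addnn -{2}[deg D x]degE -(count_predC (inside (S :\ x))).
congr addn; have [uD sD iD _ _] := tD.
rewrite [RHS](count_predIC _ (fun e => e.1.1 == x)); congr addn.
all: apply: eq_in_count => e De.
  by rewrite /= /inside !inE; case: (e.1.1 == x); rewrite /= ?andbF.
have := td_loopless tD De; have /andP[e1 e2] := iD _ De.
rewrite /= /inside !inE e1 e2 !andbT negb_and !negbK.
by case: (eqVneq e.1.1 x) => [->|_] //=; rewrite ?andbT // eq_sym => /negbTE->.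
Qed.

(** The degrees sum to [4 * #|S| - 4], so their average is below 4. *)
Lemma exists_deg_le3 S D : tight_darts S D -> exists2 x, x \in S & (deg D x <= 3)%N.
Proof.
move=> [_ _ iD _ szD]; apply/exists_inP; apply: contraT.
rewrite negb_exists_in => /forall_inP deg4.
have : (\sum_(x in S) 4 <= \sum_(x in S) deg D x)%N.
  by apply: leq_sum => x /deg4; rewrite -ltnNge.
rewrite (sum_deg iD) sum_nat_const; lia.
Qed.

(** Deleting [x] removes [2 * deg D x] darts, and sparsity on the rest demands that at least 4
    go. *)
Lemma td_deg_ge2 S D x : tight_darts S D -> x \in S -> (1 < #|S|)%N ->
  (2 <= deg D x)%N.
Proof.
move=> tD xS S1; have := count_delete x tD; have [_ _ _ spD szD] := tD.
have := spD (S :\ x); rewrite -card_gt0; have := cardsD1 x S; rewrite xS.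
case: (#|S :\ x|) => [|k]; first lia.
move=> h /(_ isT); lia.
Qed.

Lemma starE S D x : tight_darts S D -> {in D, forall e,
  [|| inside (S :\ x) e, e.1.1 == x | e.1.2 == x]}.
Proof.
move=> [_ _ iD _ _] e /iD /andP[e1 e2]; rewrite /inside !inE e1 e2 !andbT.
by do 2 case: eqP.
Qed.

(** Base case of two vertices joined by two parallel edges: the other vertex stays at the origin and
    [v] goes to a point that gives [e] and [f] opposite colours, so each colour contains one
    edge. *)
Lemma place_double_edge S D v e f : tight_darts S D -> #|S| = 2%N ->
  e \in D -> f \in D -> e != f -> e.1.1 = v -> f.1.1 = v ->
  {in D, forall g, g.1.1 = v -> g \in [:: e; f]} ->
  exists p, bicoloured p S D.
Proof.
move=> tD S2 De Df ef ev fv star; have [uD sD iD spD szD] := tD.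
have /andP[vS uS] := iD _ De; rewrite ev in vS; set u := e.1.2 in uS.
have SE : S :\ v = [set u].
  have /eqP/cards1P[w Sw] : #|S :\ v| = 1%N by have := cardsD1 v S; rewrite vS; lia.
  have : u \in S :\ v by rewrite !inE uS andbT -ev eq_sym (td_loopless tD De).
  by rewrite Sw inE => /eqP ->.
have fu : f.1.2 = u.
  apply/set1P; rewrite -SE !inE -fv eq_sym (td_loopless tD Df) /=.
  by have /andP[] := iD _ Df.
have uv : u != v by have := set11 u; rewrite -SE !inE => /andP[].
have [|Z [Ze Zf]] := @opposite_cones_meet R e.2 f.2.
  apply: contra ef => /eqP e2; apply/eqP; apply: pair_ext => //.
  by apply: pair_ext; rewrite ?ev ?fv.
pose p x := if x == v then Z else (0 : R * R).
have pe : coloured false p e.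
  rewrite /coloured /disp /p ev eqxx (negbTE uv) expr0 mul1r /= !subr0; exact: Ze.
have pf : coloured true p f.
  rewrite /coloured /disp /p fv fu eqxx (negbTE uv) expr1 mulN1r /= !subr0 oppr_gt0.
  exact: Zf.
have pst g : g \in [:: e; f] -> exists s, coloured s p g.
  by rewrite !inE => /orP[]/eqP->; [exists false | exists true].
exists p; split=> [g Dg|s h Dh].
  have /or3P[] := starE v tD Dg.
  - rewrite SE /inside !inE => /andP[/eqP g1 /eqP g2].
    by have := td_loopless tD Dg; rewrite g1 g2 eqxx.
  - by move=> /eqP gv; apply: pst; apply: star.
  move=> /eqP gv; have [|s] := pst (rdart g); last by rewrite coloured_rdart; exists s.
  exact: (star _ (sD _ Dg) gv).
have huv : h v = h u.
  by case: s Dh => Dh; [have := Dh _ Df pf|have := Dh _ De pe]; rewrite ?fv ?fu ?ev.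
have hu x : x \in S -> h x = h u.
  have [-> //|xv xS] := eqVneq x v.
  suff /set1P -> : x \in [set u] by [].
  by rewrite -SE !inE xv xS.
by move=> x y /hu -> /hu ->.
Qed.

(** For darts with a common tail its displacement is [disp p f - disp p e]: the offsets balance
    around the triangle formed with [e] and [f]. *)
Definition chord e f : dart R V := (e.1.2, f.1.2, f.2 - e.2).

Lemma rdart_chord e f : rdart (chord e f) = chord f e.
Proof. by rewrite /rdart /chord /= opprB. Qed.

Definition no_proper_tight S D : Prop := forall T, T \proper S -> (1 < #|T|)%N ->
  (count (inside T) D + 4 != 4 * #|T|)%N.

(** A proper subset with at least two vertices is not tight and its count is even, so it has room
    for both darts of the new edge. Deleting a vertex of degree 3 removes 6 darts and the chord
    restores 2, matching the loss of 4 in the bound. *)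
Lemma tight_darts_henneberg S D v e f : tight_darts S D -> no_proper_tight S D ->
  v \in S -> deg D v = 3%N -> e \in D -> f \in D -> e.1.1 = v -> f.1.1 = v ->
  e.1.2 != f.1.2 -> chord e f \notin D ->
  tight_darts (S :\ v)
    [:: chord e f, chord f e & [seq g <- D | inside (S :\ v) g]].
Proof.
move=> tD npt vS deg3 De Df ev fv ef nD; have [uD sD iD spD szD] := tD.
have nD' : chord f e \notin D.
  by rewrite -rdart_chord; apply: contra nD => /sD; rewrite rdartK.
have inS g : g \in D -> g.1.1 = v -> g.1.2 \in S :\ v.
  move=> Dg gv; rewrite !inE -gv eq_sym (td_loopless tD Dg).
  by have /andP[] := iD _ Dg.
split.
- rewrite /= !inE !mem_filter (negbTE nD) (negbTE nD') !andbF filter_uniq // !andbT orbF.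
  by apply: contra ef => /eqP/(congr1 (fun g => g.1.1)) /= ->.
- move=> g; rewrite !inE => /or3P[/eqP->|/eqP->|].
  + by rewrite rdart_chord eqxx orbT.
  + by rewrite rdart_chord eqxx.
  rewrite !mem_filter => /andP[gS /sD ->]; move: gS.
  by rewrite /inside /= andbC => ->; rewrite !orbT.
- move=> g; rewrite !inE => /or3P[/eqP->|/eqP->|].
  + by rewrite /inside /chord /= !inS.
  + by rewrite /inside /chord /= !inS.
  by rewrite mem_filter => /andP[].
- move=> T T0; pose T' := T :&: (S :\ v).
  have cT' : count (inside T) [seq g <- D | inside (S :\ v) g] = count (inside T') D.
    rewrite count_filter; apply: eq_count => g; rewrite /= /inside !inE.
    by do ! case: (_ \in _) => //=; rewrite ?andbT ?andbF.
  have T'T : (#|T'| <= #|T|)%N by rewrite subset_leq_card // subsetIl.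
  have T'S : T' \proper S.
    apply/properP; split; last by exists v; rewrite // !inE eqxx andbF.
    by apply: subset_trans (subsetIr _ _) (subsetDl _ _).
  have cfe : inside T (chord f e) = inside T (chord e f) by rewrite /inside /= andbC.
  rewrite /= cT' cfe {1 2}/inside /=.
  have [/andP[eT fT]|_] := boolP ((e.1.2 \in T) && (f.1.2 \in T)).
    have T'1 : (1 < #|T'|)%N.
      apply/card_gt1P; exists f.1.2, e.1.2; rewrite ?inE ?eT ?fT; split=> //.
      - by have := inS _ Df fv; rewrite !inE.
      - by have := inS _ De ev; rewrite !inE.
      by rewrite eq_sym.
    have := npt _ T'S T'1; have := count_inside_even T' tD.
    have := spD T'; rewrite -card_gt0 (ltnW T'1) => /(_ isT).
    by move: (count _ D) #|T'| #|T| T'T; clear => c a b; lia.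
  have [T'0|T'0] := eqVneq T' set0; last first.
    have := spD _ T'0.
    by move: (count _ D) #|T'| #|T| T'T; clear => c a b; lia.
  rewrite T'0 (@eq_count _ _ pred0) ?count_pred0; last first.
    by move=> g; rewrite /inside !inE.
  by move: T0; rewrite -card_gt0; move: #|T|; clear => b; lia.
rewrite [size _]/= size_filter; have := count_delete v tD; rewrite deg3.
have := cardsD1 v S; rewrite vS. move: szD.
by move: (count _ D) (size D) #|S| #|S :\ v|; clear => c a b d; lia.
Qed.


(** If the chord has colour [s], then [v] is placed so that [e] and [f] have colour [s] and [g] the
    other one. The path through [v] replaces the chord in colour [s], and [g] attaches [v] to the
    other colour class. *)
Lemma place_henneberg S D v e f g p : tight_darts S D -> v \in S ->
  e \in D -> f \in D -> g \in D -> e.1.1 = v -> f.1.1 = v -> g.1.1 = v ->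
  e.1.2 != g.1.2 -> f.1.2 != g.1.2 ->
  {in D, forall e', e'.1.1 = v -> e' \in [:: e; f; g]} ->
  bicoloured p (S :\ v)
    [:: chord e f, chord f e & [seq e' <- D | inside (S :\ v) e']] ->
  exists p', bicoloured p' S D.
Proof.
move=> tD vS De Df Dg ev fv gv eg fg star bp; have [uD sD iD spD szD] := tD.
(* Avoiding these two differences makes [p g.1.2 + g.2] distinct from the corresponding points of
   [e] and [f]. *)
have [{bp}p [pD pS] gen] := bicoloured_generic [:: g.2 - e.2; g.2 - f.2] bp.
have [s cs] := pD _ (mem_head _ _).
have [|||Z [Ze Zf Zg]] := @three_cones_meet R s (p e.1.2 + e.2) (p f.1.2 + f.2)
    (p g.1.2 + g.2).
- suff -> : p e.1.2 + e.2 - (p f.1.2 + f.2) = disp p (chord e f) by [].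
  by apply: pair_ext; rewrite /disp /=; ring.
- apply: contra (gen _ _ _ eg (mem_head _ _)) => /eqP h; apply/eqP.
  by apply: pair_ext; move: (congr1 fst h) (congr1 snd h) => /=; lra.
- have : g.2 - f.2 \in [:: g.2 - e.2; g.2 - f.2] by rewrite !inE eqxx orbT.
  move=> /(gen _ _ _ fg); apply: contra => /eqP h; apply/eqP.
  by apply: pair_ext; move: (congr1 fst h) (congr1 snd h) => /=; lra.
pose q x := if x == v then Z else p x.
have qE e' (s' : bool) : e' \in D -> e'.1.1 = v ->
    0 < (-1) ^+ s' * ((Z - (p e'.1.2 + e'.2)).1 * (Z - (p e'.1.2 + e'.2)).2) ->
    coloured s' q e'.
  move=> De' ev' h; have := td_loopless tD De'; rewrite eq_sym ev' => /negbTE nv.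
  by rewrite /coloured /disp /q ev' eqxx nv -addrA -opprD.
have qN e' s' : inside (S :\ v) e' -> coloured s' q e' = coloured s' p e'.
  by rewrite /inside !inE => /andP[/andP[/negbTE n1 _] /andP[/negbTE n2 _]];
    rewrite /coloured /disp /q n1 n2.
have qe := qE _ _ De ev Ze; have qf := qE _ _ Df fv Zf; have qg := qE _ _ Dg gv Zg.
have qst e' : e' \in D -> e'.1.1 = v -> exists s', coloured s' q e'.
  move=> De' /(star _ De'); rewrite !inE => /or3P[]/eqP->.
  - by exists s.
  - by exists s.
  by exists (~~ s).
have gS : g.1.2 \in S :\ v.
  rewrite !inE -gv eq_sym (td_loopless tD Dg); by have /andP[] := iD _ Dg.
have eS : e.1.2 \in S :\ v.
  rewrite !inE -ev eq_sym (td_loopless tD De); by have /andP[] := iD _ De.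
exists q; split=> [e' De'|s' h Dh].
  have /or3P[h|/eqP h|/eqP h] := starE v tD De'.
  - have [|s' hs'] := pD e'; first by rewrite !inE mem_filter h De' !orbT.
    by exists s'; rewrite qN.
  - exact: qst.
  by have [s'] := qst _ (sD _ De') h; rewrite coloured_rdart; exists s'.
have hp e' : e' \in [seq e' <- D | inside (S :\ v) e'] -> coloured s' p e' ->
    h e'.1.1 = h e'.1.2.
  by rewrite mem_filter => /andP[ie De'] c'; apply: Dh => //; rewrite qN.
have [hS [u uS hvu]] : {in S :\ v &, forall x y, h x = h y} /\
    exists2 u, u \in S :\ v & h v = h u.
  have [ss|ss] := eqVneq s' s; last first.
    have {}ss : s' = ~~ s by case: (s) (s') ss => [] [].
    split; last by exists g.1.2; rewrite // -{1}gv; apply: Dh; rewrite // ss.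
    apply: (pS s') => e'; rewrite !inE => /or3P[/eqP->|/eqP->|]; last exact: hp.
      by rewrite ss coloured_uniq.
    by rewrite -rdart_chord coloured_rdart ss coloured_uniq.
  have hve : h v = h e.1.2 by rewrite -{1}ev; apply: Dh; rewrite // ss.
  have hvf : h v = h f.1.2 by rewrite -{1}fv; apply: Dh; rewrite // ss.
  split; last by exists e.1.2.
  apply: (pS s') => e'; rewrite !inE => /or3P[/eqP->|/eqP->|]; last exact: hp.
    by rewrite /= -hve.
  by rewrite /= -hve.
have hx x : x \in S -> h x = h u.
  have [-> //|xv xS] := eqVneq x v.
  by apply: hS; rewrite // !inE xv.
by move=> x y /hx -> /hx ->.
Qed.

(* The two colour classes of the permutation 2 4 1 3 on four points are both
   Hamiltonian paths: concordant pairs 2-1-4-3, discordant pairs 1-3-2-4. *)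
Lemma place_K4 S D v u1 u2 u3 (d1 d2 d3 : R * R) :
  let e1 : dart R V := (v, u1, d1) in let e2 : dart R V := (v, u2, d2) in
  let e3 : dart R V := (v, u3, d3) in
  tight_darts S D -> no_proper_tight S D -> uniq [:: v; u1; u2; u3] ->
  {subset [:: e1; e2; e3; chord e1 e2; chord e1 e3; chord e2 e3] <= D} ->
  exists p, bicoloured p S D.
Proof.
move=> e1 e2 e3 tD npt uu LD; have [uD sD iD spD szD] := tD.
set L := [:: e1; e2; e3; chord e1 e2; chord e1 e3; chord e2 e3] in LD *.
set T := [set v; u1; u2; u3].
have T4 : #|T| = 4%N.
  rewrite -[4%N]/(size [:: v; u1; u2; u3]) -(card_uniqP uu); apply: eq_card => x.
  by rewrite !inE !orbA.
pose L2 := L ++ [seq rdart e | e <- L].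
have L2D : {subset L2 <= D}.
  move=> e; rewrite mem_cat => /orP[/LD //|/mapP[f /LD/sD fD ->] //].
have uL2 : uniq L2.
  apply: (@map_uniq _ _ fst); move: uu.
  rewrite /= !inE !xpair_eqE !negb_or => /and4P[/and3P[n1 n2 n3] /andP[n4 n5] n6 _].
  rewrite ?(eq_sym u1 v) ?(eq_sym u2 v) ?(eq_sym u3 v) ?(eq_sym u2 u1) ?(eq_sym u3 u1)
    ?(eq_sym u3 u2).
  by rewrite ?(negbTE n1) ?(negbTE n2) ?(negbTE n3) ?(negbTE n4) ?(negbTE n5) ?(negbTE n6)
    /= ?andbF.
have L2T e : e \in L2 -> inside T e.
  have LT f : f \in L -> inside T f.
    by rewrite !inE /inside => /or4P[/eqP->|/eqP->|/eqP->|/or3P[/eqP->|/eqP->|/eqP->]];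
      rewrite !inE !eqxx ?orbT.
  rewrite mem_cat => /orP[/LT //|/mapP[f /LT fT ->]].
  by move: fT; rewrite /inside andbC.
(* Twelve darts on four vertices attain the bound [4 * 4 - 4]; hence [T] is all of [S] and [D] has
   no further darts. *)
have cT : (12 <= count (inside T) D)%N.
  rewrite -[12%N]/(size L2) -size_filter; apply: uniq_leq_size => // e eL.
  by rewrite mem_filter L2T // L2D.
have TS : T \subset S.
  have [[/iD/andP[? ?] /iD/andP[_ ?]] /iD/andP[_ ?]] : (e1 \in D /\ e2 \in D) /\ e3 \in D.
    by do !split; apply: LD; rewrite !inE eqxx ?orbT.
  by rewrite !subUset !sub1set; do !(apply/andP; split).
have eTS : T = S.
  apply/eqP; rewrite eqEproper TS /=; apply/negP => pTS.
  have := npt _ pTS; rewrite T4 => /(_ isT).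
  have := spD T; rewrite -card_gt0 T4 => /(_ isT); lia.
have [|_ DL2] := uniq_min_size uL2 L2D.
  by move: szD; rewrite -eTS T4 [size L2]/=; move: (size D); clear => c; lia.
(* Subtracting [d1], [d2], [d3] cancels every offset, including those of the chords, so all six
   displacements are differences of the points (1, 2), (2, 4), (3, 1), (4, 3). *)
pose p x : R * R := if x == v then (1, 2%:R) else if x == u1 then (2%:R, 4%:R) - d1
  else if x == u2 then (3%:R, 1) - d2 else (4%:R, 3%:R) - d3.
have [pv [p1 [p2 p3]]] : p v = (1, 2%:R) /\ p u1 = (2%:R, 4%:R) - d1 /\
    p u2 = (3%:R, 1) - d2 /\ p u3 = (4%:R, 3%:R) - d3.
  move: uu; rewrite /= !inE !negb_or => /and4P[/and3P[n1 n2 n3] /andP[n4 n5] n6 _].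
  rewrite /p eqxx ?(eq_sym u1 v) ?(eq_sym u2 v) ?(eq_sym u3 v) ?(eq_sym u2 u1)
    ?(eq_sym u3 u1) ?(eq_sym u3 u2).
  by rewrite (negbTE n1) (negbTE n2) (negbTE n3) (negbTE n4) (negbTE n5)
    (negbTE n6) !eqxx.
have c1 : coloured false p e1 by rewrite /coloured /disp /= pv p1 /=; lra.
have c2 : coloured true p e2 by rewrite /coloured /disp /= pv p2 /=; lra.
have c3 : coloured false p e3 by rewrite /coloured /disp /= pv p3 /=; lra.
have c12 : coloured true p (chord e1 e2) by rewrite /coloured /disp /= p1 p2 /=; lra.
have c13 : coloured true p (chord e1 e3) by rewrite /coloured /disp /= p1 p3 /=; lra.
have c23 : coloured false p (chord e2 e3) by rewrite /coloured /disp /= p2 p3 /=; lra.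
have pL e : e \in L -> exists s, coloured s p e.
  by rewrite !inE => /or4P[/eqP->|/eqP->|/eqP->|/or3P[/eqP->|/eqP->|/eqP->]];
    [exists false|exists true|exists false|exists true|exists true|exists false].
exists p; split=> [e|s h Dh].
  rewrite -DL2 mem_cat => /orP[/pL //|/mapP[f /pL [s fs] ->]].
  by exists s; rewrite coloured_rdart.
have Lh e : e \in L -> coloured s p e -> h e.1.1 = h e.1.2 by move=> /LD /Dh.
suff hT x : x \in S -> h x = h v by move=> x y /hT -> /hT ->.
have := Lh e1; have := Lh e2; have := Lh e3; have := Lh (chord e1 e2).
have := Lh (chord e1 e3); have := Lh (chord e2 e3).
rewrite !inE !eqxx ?orbT /= -eTS !inE => /(_ isT) h23 /(_ isT) h13 /(_ isT) h12.
move=> /(_ isT) h3 /(_ isT) h2 /(_ isT) h1.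
case: s {Dh Lh} h23 h13 h12 h3 h2 h1 => h23 h13 h12 h3 h2 h1.
  have := h2 c2; have := h12 c12; have := h13 c13.
  by move=> E1 E2 E3 /orP[/orP[/orP[]|]|] /eqP -> //; congruence.
have := h1 c1; have := h3 c3; have := h23 c23.
by move=> E1 E2 E3 /orP[/orP[/orP[]|]|] /eqP -> //; congruence.
Qed.


Lemma tight_darts_inside S D T : tight_darts S D ->
  (count (inside T) D + 4 = 4 * #|T|)%N ->
  tight_darts T [seq e <- D | inside T e].
Proof.
move=> [uD sD iD spD szD] tT; split=> [|e|e|U U0|].
- exact: filter_uniq.
- rewrite !mem_filter => /andP[eT /sD ->]; rewrite andbT.
  by move: eT; rewrite /inside andbC.
- by rewrite mem_filter => /andP[].
- apply: leq_trans (spD U U0); rewrite leq_add2r count_filter.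
  by apply: sub_count => e /andP[].
by rewrite size_filter.
Qed.

(** Two parallel edges give 4 darts on 2 vertices, a tight pair, which is proper because [S] has a
    third vertex. *)
Lemma star_neighbours_neq S D e f : tight_darts S D -> no_proper_tight S D ->
  (2 < #|S|)%N -> e \in D -> f \in D -> e != f -> e.1.1 = f.1.1 -> e.1.2 != f.1.2.
Proof.
move=> tD npt S3 De Df ef ef1; apply/eqP => ef2; have [uD sD iD spD _] := tD.
have e12 := td_loopless tD De; set T := [set e.1.1; e.1.2].
have T2 : #|T| = 2%N by rewrite cards2 e12.
have pTS : T \proper S.
  rewrite properEcard T2 S3 andbT; have /andP[h1 h2] := iD _ De.
  by rewrite subUset !sub1set h1 h2.
have := npt _ pTS; rewrite T2 => /(_ isT)/eqP; apply.
suff : (4 <= count (inside T) D)%N.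
  have := spD T; rewrite -card_gt0 T2 => /(_ isT).
  by move: (count _ _); clear => c; lia.
rewrite -[4%N]/(size [:: e; f; rdart e; rdart f]) -size_filter; apply: uniq_leq_size.
  have er g g' : g \in [:: e; f] -> g' \in [:: e; f] -> g != rdart g'.
    have h k : k \in [:: e; f] -> k.1.1 = e.1.1 /\ k.1.2 = e.1.2.
      by rewrite !inE => /orP[]/eqP->.
    move=> /h[g1 _] /h[_ g2]; apply/eqP => /(congr1 (fun k => k.1.1)) /=.
    by rewrite g1 g2; apply/eqP.
  have [ee fe] : e \in [:: e; f] /\ f \in [:: e; f] by rewrite !inE !eqxx orbT.
  rewrite /= !inE !negb_or ef (er e e) // (er e f) // (er f e) // (er f f) //= andbT.
  by apply: contra ef => /eqP/(can_inj (@rdartK _ _)) ->.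
have eT : inside T e by rewrite /inside !inE !eqxx orbT.
have fT : inside T f by rewrite /inside !inE -ef1 -ef2 !eqxx orbT.
move=> g; rewrite mem_filter !inE => /or4P[]/eqP->; rewrite ?eT ?fT ?sD //.
  by move: eT; rewrite /inside andbC => ->.
by move: fT; rewrite /inside andbC => ->.
Qed.

Theorem tight_darts_bicoloured S D : S != set0 -> tight_darts S D ->
  exists p, bicoloured p S D.
Proof.
have [n] := ubnP #|S|; elim: n S D => // n IHn S D; rewrite ltnS => Sn S0 tD.
have [uD sD iD spD szD] := tD.
have [S1|S1] := leqP #|S| 1.
  have {}S1 : #|S| = 1%N by apply/eqP; rewrite eqn_leq S1 card_gt0.
  have D0 : D = [::] by apply/nilP; move: szD; rewrite /nilp S1;
    move: (size D); clear => a; lia.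
  exists (fun=> 0); rewrite D0; split=> // _ h _ x y.
  by have /eqP/cards1P[z ->] := S1; rewrite !inE => /eqP -> /eqP ->.
(* Both a proper tight [T] with at least two vertices and the set left after its contraction are
   smaller than [S], so the induction hypothesis places each. *)
have [/existsP[T /and3P[pTS T1 /eqP tT]]|npt] := boolP [exists T : {set V},
    [&& T \proper S, (1 < #|T|)%N & (count (inside T) D + 4 == 4 * #|T|)%N]].
  have T0 : T != set0 by rewrite -card_gt0 ltnW.
  have [h hT] := set0Pn _ T0; have TS := proper_card pTS.
  have [|q0 bq0] := IHn T _ _ T0 (tight_darts_inside tD tT).
    exact: leq_trans TS Sn.
  have [q bq gq] := bicoloured_generic [seq e.2 - f.2 | e <- D, f <- D] bq0.
  have tD' : tight_darts (h |: (S :\: T))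
      [seq contract h T q e | e <- D & ~~ inside T e].
    apply: tight_darts_contract => //; first exact: proper_sub.
    by move=> x y e f xy De Df; apply: gq => //; apply: allpairs_f.
  have [||p bp] := IHn _ _ _ _ tD'.
  - rewrite cardsU1 !inE hT /=; apply: leq_trans Sn.
    have := cardsID T S; rewrite (setIidPr (proper_sub pTS)).
    by move: T1; move: #|S| #|T| #|_ :\: _|; clear => a b c; lia.
  - by apply/set0Pn; exists h; rewrite !inE eqxx.
  by exists (expand h T q p); apply: bicoloured_expand bq bp.
have {}npt : no_proper_tight S D.
  move=> T pTS T1; move: npt; rewrite negb_exists => /forallP/(_ T).
  by rewrite pTS T1.
have [v vS deg_le3] := exists_deg_le3 tD; have deg_ge2 := td_deg_ge2 tD vS S1.
have cdel := count_delete v tD; have cS := cardsD1 v S; rewrite vS in cS.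
have star : exists s, [/\ uniq s, size s = deg D v,
    {in s, forall e, e \in D /\ e.1.1 = v} &
    {in D, forall e, e.1.1 = v -> e \in s}].
  exists [seq e <- D | e.1.1 == v]; split; first exact: filter_uniq.
  - by rewrite size_filter.
  - by move=> e; rewrite mem_filter => /andP[/eqP ? ?].
  by move=> e De ev; rewrite mem_filter ev eqxx.
have [deg2|deg3] : deg D v = 2%N \/ deg D v = 3%N.
  by move: (deg D v) deg_ge2 deg_le3; clear => c; lia.
  have [s [us + sDv star']] := star; rewrite deg2.
  case: s us sDv star' => [|e [|f [|? ?]]] // us sDv star' _.
  have [De ev] := sDv _ (mem_head _ _).
  have [Df fv] : f \in D /\ f.1.1 = v by apply: sDv; rewrite !inE eqxx orbT.
  apply: (place_double_edge tD _ De Df) (star') => //; last first.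
    by move: us; rewrite /= inE andbT.
  (* Deleting a vertex of degree 2 leaves a tight set, which must then be a single vertex. *)
  have /npt : S :\ v \proper S by apply: properD1.
  move: cdel szD S1; rewrite deg2; move: cS.
  move: (count _ D) (size D) #|S| #|S :\ v|; clear => a b c d ? ? ? ? h.
  by case: (ltnP 1 d) => [/h|]; lia.
(* The 6 darts at [v] exceed the 4 that two vertices admit. *)
have S3 : (2 < #|S|)%N.
  by move: cdel szD; rewrite deg3; move: (count _ D) (size D) #|S|; clear => a b c; lia.
have [s [us + sDv star']] := star; rewrite deg3.
case: s us sDv star' => [|e [|f [|g [|? ?]]]] // us sDv star' _.
have [De ev] := sDv _ (mem_head _ _).
have [Df fv] : f \in D /\ f.1.1 = v by apply: sDv; rewrite !inE eqxx orbT.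
have [Dg gv] : g \in D /\ g.1.1 = v by apply: sDv; rewrite !inE eqxx !orbT.
have [ef eg fg] : [/\ e.1.2 != f.1.2, e.1.2 != g.1.2 & f.1.2 != g.1.2].
  move: us; rewrite /= !inE negb_or andbT => /andP[/andP[? ?] ?].
  by split; apply: star_neighbours_neq tD npt S3 _ _ _ _ => //; rewrite ?ev ?fv ?gv.
have henneberg e1 e2 e3 : [/\ e1 \in D, e2 \in D & e3 \in D] ->
    [/\ e1.1.1 = v, e2.1.1 = v & e3.1.1 = v] ->
    [/\ e1.1.2 != e2.1.2, e1.1.2 != e3.1.2 & e2.1.2 != e3.1.2] ->
    {subset [:: e; f; g] <= [:: e1; e2; e3]} ->
    chord e1 e2 \notin D -> exists p, bicoloured p S D.
  move=> [D1 D2 D3] [v1 v2 v3] [n12 n13 n23] sub nD.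
  have tD' := tight_darts_henneberg tD npt vS deg3 D1 D2 v1 v2 n12 nD.
  have [||p bp] := IHn _ _ _ _ tD'.
  - by apply: leq_trans Sn; rewrite cS.
  - by rewrite -card_gt0; move: cS S1; move: #|S| #|S :\ v|; clear => a b; lia.
  apply: (place_henneberg tD vS D1 D2 D3 v1 v2 v3 n13 n23 _ bp) => e' De' ev'.
  exact/sub/star'.
(* Any chord missing from [D] allows the inverse move; if none is missing, [v] and its neighbours
   span the balanced copy of K4. *)
have [c1|] := boolP (chord e f \in D); last exact: (henneberg e f g).
have [c2|] := boolP (chord e g \in D); last first.
  apply: (henneberg e g f) => //; first by split=> //; rewrite eq_sym.
  by move=> k; rewrite !inE => /or3P[]->; rewrite ?orbT.
have [c3|] := boolP (chord f g \in D); last first.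
  apply: (henneberg f g e) => //; first by split=> //; rewrite eq_sym.
  by move=> k; rewrite !inE => /or3P[]->; rewrite ?orbT.
have ne := td_loopless tD De; have nf := td_loopless tD Df; have ng := td_loopless tD Dg.
move: De Df Dg ev fv gv ef eg fg c1 c2 c3 ne nf ng.
case: e f g {us sDv star' henneberg} => [[? u1] d1] [[? u2] d2] [[? u3] d3] /=.
move=> De Df Dg /= ev fv gv; rewrite {}ev {}fv {}gv in De Df Dg *.
move=> n12 n13 n23 c1 c2 c3 n1 n2 n3.
apply: (@place_K4 S D v u1 u2 u3 d1 d2 d3) => //.
  by rewrite /= !inE !negb_or n1 n2 n3 n12 n13 n23.
by move=> k; rewrite !inE => /or4P[/eqP->|/eqP->|/eqP->|/or3P[]/eqP->].
Qed.

End Placement.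


(** * Rank counts for a rigidity matrix with arbitrary edge directions *)

Section LinearCount.
Variables (K : fieldType) (d : nat) (V E : finType).
Variables (s t : E -> V) (k : E -> 'cV[K]_d).

Definition stretch (w : V -> 'rV[K]_d) (e : E) : K := ((w (s e) - w (t e)) *m k e) 0 0.

Let stretch_ffun (w : {ffun V -> 'rV[K]_d}) : {ffun E -> K^o} := [ffun e => stretch w e].

Let stretch_ffun_linear : linear stretch_ffun.
Proof.
move=> a u v; apply/ffunP => e; rewrite !ffunE /stretch !ffunE.
have -> : a *: u (s e) + v (s e) - (a *: u (t e) + v (t e)) =
    a *: (u (s e) - u (t e)) + (v (s e) - v (t e)).
  by rewrite scalerBr opprD addrACA.
by rewrite mulmxDl -scalemxAl !mxE.
Qed.
HB.instance Definition _ := GRing.isLinear.Build K _ _ _ stretch_ffun stretch_ffun_linear.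

Let const (c : 'rV[K]_d) : {ffun V -> 'rV[K]_d} := [ffun _ => c].
Let const_linear : linear const.
Proof. by move=> a u v; apply/ffunP => x; rewrite !ffunE. Qed.
HB.instance Definition _ := GRing.isLinear.Build K _ _ _ const const_linear.

Let phi := linfun stretch_ffun.
Let consts := limg (linfun const).

Let dim_consts : (0 < #|V|)%N -> \dim consts = d.
Proof.
move=> /card_gt0P[x0 _]; rewrite limg_dim_eq; first by rewrite dimvf /= dim_matrix mul1r.
rewrite capfv; apply/eqP/lker0P => a b; rewrite !lfunE /=.
by move=> /ffunP/(_ x0); rewrite !ffunE.
Qed.

Let consts_ker : (consts <= lker phi)%VS.
Proof.
apply/subvP => w /memv_imgP[c _ ->]; rewrite memv_ker !lfunE /=.
by apply/eqP/ffunP => e; rewrite !ffunE /stretch !ffunE subrr mul0mx mxE.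
Qed.

Let rank_nullity : (\dim (lker phi) + \dim (limg phi) = d * #|V|)%N.
Proof.
have := limg_ker_dim phi fullv; rewrite capfv => ->; rewrite dimvf.
by rewrite -[LHS]/(#|V| * (1 * d))%N mul1n mulnC.
Qed.

(** The hypothesis puts every coordinate vector in the image, so [phi] is onto. Its kernel contains
    the [d]-dimensional space of constants, and rank-nullity gives the bound. *)
Lemma stretch_independent_count : (0 < #|V|)%N ->
  (forall e, exists2 w, stretch w e != 0 & forall f, f != e -> stretch w f = 0) ->
  (#|E| + d <= d * #|V|)%N.
Proof.
move=> V0 indep; rewrite -rank_nullity addnC leq_add //.
  exact: leq_trans (eq_leq (esym (dim_consts V0))) (dimvS consts_ker).
suff -> : limg phi = fullv by rewrite dimvf -[leqRHS]/(#|E| * 1)%N muln1.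
apply/vspaceP => g; rewrite memvf.
have -> : g = \sum_e g e *: ([ffun f => (f == e)%:R] : {ffun E -> K^o}).
  apply/ffunP => e; rewrite sum_ffunE (bigD1 e) //= big1 ?addr0.
    by rewrite !ffunE eqxx /= /GRing.scale /= mulr1.
  by move=> f fe; rewrite !ffunE eq_sym (negbTE fe) scaler0.
apply: rpred_sum => e _; apply: rpredZ; have [w we wf] := indep e.
have -> : [ffun f => (f == e)%:R] = (stretch w e)^-1 *: phi [ffun x => w x].
  apply/ffunP => f; rewrite lfunE /= !ffunE.
  have -> : stretch [ffun x => w x] f = stretch w f by rewrite /stretch !ffunE.
  have [->|/wf ->] := eqVneq f e; last by rewrite scaler0.
  by rewrite /GRing.scale /= mulVf.
by apply: rpredZ; apply: memv_img; apply: memvf.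
Qed.

(** The kernel lies in the constants and so has dimension at most [d], while the rank is at most
    [#|E|]. *)
Lemma stretch_rigid_count : (0 < #|V|)%N ->
  (forall w, (forall e, stretch w e = 0) -> exists c, forall x, w x = c) ->
  (d * #|V| <= #|E| + d)%N.
Proof.
move=> V0 rig; rewrite -rank_nullity addnC leq_add //.
  by apply: leq_trans (dimvS (subvf _)) _; rewrite dimvf -[leqLHS]/(#|E| * 1)%N muln1.
apply: leq_trans (eq_leq (dim_consts V0)); apply/dimvS/subvP => w.
rewrite memv_ker lfunE => /eqP/ffunP w0.
have [e|c wc] := rig w; first by have := w0 e; rewrite !ffunE.
suff -> : w = linfun const c by apply: memv_img; apply: memvf.
by apply/ffunP => x; rewrite lfunE /= ffunE.
Qed.

End LinearCount.

From mathcomp Require Import classical_sets functions boolp reals.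


(** * Symmetric motions as velocities on the vertices of the gain graph *)

Section Frameworks.
Variables (R : realType) (w1 w2 : 'rV[R]_2).
Hypothesis hw : free [:: w1; w2].

Local Notation act := (lattice_act w1 w2).

Definition lattice (g : int * int) : 'rV[R]_2 := w1 *~ g.1 + w2 *~ g.2.

Lemma latticeD g h : lattice (g + h) = lattice g + lattice h.
Proof. by rewrite /lattice /= !mulrzDr addrACA. Qed.

Lemma latticeN g : lattice (- g) = - lattice g.
Proof. by rewrite /lattice /= !mulrNz opprD. Qed.

Lemma lattice_eq0 g : lattice g = 0 -> g = 0.
Proof.
case: g => a b; rewrite /lattice /= => g0.
have /freeP/(_ (fun i => if i == 0 then a%:~R else b%:~R)) := hw.
move=> /= H; have {}H : forall i : 'I_2, (if i == 0 then a%:~R else b%:~R : R) = 0.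
  apply: H; rewrite big_ord_recl big_ord1 /= !scaler_int; exact: g0.
have := H 0; have := H (lift 0 0) => /= /eqP + /eqP.
by rewrite !intr_eq0 => /eqP -> /eqP ->.
Qed.

Lemma lattice_inj : injective lattice.
Proof.
move=> g h gh; apply/eqP; rewrite -subr_eq0; apply/eqP/lattice_eq0.
by rewrite latticeD latticeN gh subrr.
Qed.

Lemma kappaN (z : 'rV[R]_2) : kappa (- z) = kappa z.
Proof. by rewrite /kappa !mxE !normrN. Qed.

Lemma dotE (a b : 'rV[R]_2) : dot a b = (b *m a^T) 0 0.
Proof. by rewrite mxE; apply: eq_bigr => i _; rewrite mxE mulrC. Qed.

Lemma linear_part_lattice g x : linear_part act g x = x.
Proof. by rewrite /linear_part /lattice_act add0r addrK. Qed.

Lemma derived_placementE (T : finType) (p : T -> 'rV[R]_2) x :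
  derived_placement act p x = p x.2 + lattice x.1.
Proof. by []. Qed.

Variables (V E : finType) (G : gain_graph (int * int)%type V E).

(** The bar of the orbit representative that starts at the identity copy of [src G e]; lattice
    translations carry it to the other bars of the orbit. *)
Definition edge_vector (p : V -> 'rV[R]_2) (e : E) : 'rV[R]_2 :=
  p (src G e) - p (dst G e) - lattice (gain G e).

(** Translations have identity linear part, so a symmetric motion is a function [w] of the quotient
    vertex alone, and each edge orbit imposes the vanishing of this one number. *)
Definition elongation (p w : V -> 'rV[R]_2) (e : E) : R :=
  stretch (src G) (dst G) (fun e => (kappa (edge_vector p e))^T) w e.

Lemma elongation_loop p w e : src G e = dst G e -> elongation p w e = 0.
Proof. by move=> e0; rewrite /elongation /stretch e0 subrr mul0mx mxE. Qed.

Lemma edge_orbit_vector p e x y : edge_orbit G e x y ->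
  derived_placement act p x - derived_placement act p y = edge_vector p e \/
  derived_placement act p x - derived_placement act p y = - edge_vector p e.
Proof.
have H g : derived_placement act p (g, src G e) -
    derived_placement act p (g + gain G e, dst G e) = edge_vector p e.
  rewrite !derived_placementE /= latticeD /edge_vector.
  move: (lattice g) (lattice (gain G e)) => a b.
  by rewrite !opprD !addrA (addrAC _ a) addrK.
by move=> [g [[-> ->]|[-> ->]]]; [left|right; rewrite -opprB]; rewrite H.
Qed.

Lemma edge_orbit_elongation p w e x y : edge_orbit G e x y ->
  dot (kappa (derived_placement act p x - derived_placement act p y))
    (w x.2 - w y.2) = 0 <-> elongation p w e = 0.
Proof.
move=> exy; have -> : kappa (derived_placement act p x - derived_placement act p y) =
    kappa (edge_vector p e).
  by case: (edge_orbit_vector p exy) => ->; rewrite ?kappaN.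
rewrite dotE /elongation /stretch; move: exy => [g [[-> ->]|[-> ->]]] //=.
rewrite -opprB mulNmx mxE; split=> /eqP; rewrite ?oppr_eq0 => /eqP // ->.
by rewrite oppr0.
Qed.

(** A common edge forces equal gains in one orientation or opposite gains in the other, and the
    matching gain axiom identifies the edges. Loops are excluded: two loops at a vertex with
    opposite gains have the same orbit. *)
Lemma edge_orbit_uniq e f x y : src G e != dst G e ->
  edge_orbit G e x y -> edge_orbit G f x y -> e = f.
Proof.
have opp (a b c : int * int) : b = a + c -> a = b - c by move=> ->; rewrite addrK.
move=> nl [g [[-> ->]|[-> ->]]] [h [[/pair_equal_spec[E1 E2] /pair_equal_spec[E3 E4]]|
  [/pair_equal_spec[E1 E2] /pair_equal_spec[E3 E4]]]].
- by apply: (@gain_parallel _ _ _ G) => //; move: E3; rewrite E1 => /addrI.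
- apply: (gain_antiparallel nl) => //; apply: (@addrI _ g).
  by rewrite [LHS]E1; apply: opp.
- apply: (gain_antiparallel nl) => //; apply: (@addrI _ g).
  by rewrite [LHS]E1; apply: opp.
by apply: (@gain_parallel _ _ _ G) => //; move: E3; rewrite E1 => /addrI.
Qed.

(* [adj] may miss orbits of loops, whose constraints are void. *)
Lemma sym_motionsP (F : pred E) (adj : (int * int) * V -> (int * int) * V -> Prop)
    (p : V -> 'rV[R]_2) (u : (int * int) * V -> 'rV[R]_2) :
  (forall x y, adj x y -> exists2 e, F e & edge_orbit G e x y) ->
  (forall e x y, F e -> src G e != dst G e -> edge_orbit G e x y -> adj x y) ->
  sym_motions act adj (derived_placement act p) u <->
  exists2 w : V -> 'rV[R]_2, u = (fun x => w x.2) &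
    forall e, F e -> elongation p w e = 0.
Proof.
move=> adjF Fadj; split=> [[um us]|[w -> w0]].
  have uE x : u x = u (0, x.2).
    case: x => g v; have := us g (0, v); rewrite linear_part_lattice => <-.
    by rewrite /vact /= addr0.
  exists (fun v => u (0, v)) => [|e Fe]; first by apply: funext => x; exact: uE.
  have [e0|e0] := eqVneq (src G e) (dst G e); first exact: elongation_loop.
  have ex : edge_orbit G e (0, src G e) (0 + gain G e, dst G e) by exists 0; left.
  apply/(edge_orbit_elongation p (fun v => u (0, v)) ex) => /=.
  by rewrite -[u (0, dst G e)](uE (0 + gain G e, dst G e)); apply/um/(Fadj e).
split=> [x y /adjF [e Fe exy]|g x]; last by rewrite linear_part_lattice.
by apply/(edge_orbit_elongation p w exy)/w0.
Qed.

Definition rigid_on (F : pred E) (p : V -> 'rV[R]_2) : Prop :=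
  forall w : V -> 'rV[R]_2, (forall e, F e -> elongation p w e = 0) ->
    exists c, forall x, w x = c.

Lemma sym_inf_rigidP (F : pred E) adj p :
  (forall x y, adj x y -> exists2 e, F e & edge_orbit G e x y) ->
  (forall e x y, F e -> src G e != dst G e -> edge_orbit G e x y -> adj x y) ->
  sym_inf_rigid act adj (derived_placement act p) <-> rigid_on F p.
Proof.
move=> adjF Fadj; have mP u := @sym_motionsP F adj p u adjF Fadj.
split=> [rig w w0|rig u /mP[w -> /rig [c wc]]]; last by exists c.
have [|c wc] := rig (fun x => w x.2); first by apply/mP; exists w.
by exists c => x; exact: (wc (0, x)).
Qed.

Lemma derived_adjP x y : derived_adj G x y -> exists2 e, predT e & edge_orbit G e x y.
Proof. by case=> e; exists e. Qed.

Lemma sym_inf_rigid_derived p :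
  sym_inf_rigid act (derived_adj G) (derived_placement act p) <-> rigid_on predT p.
Proof. by apply: sym_inf_rigidP => [|e x y _ _ exy]; [exact: derived_adjP|exists e]. Qed.

(** If [e0] is a loop, removing its orbit may also remove that of the loop with opposite gain; no
    constraint is lost, since loops have zero elongation. *)
Lemma sym_inf_rigid_derived_minus e0 p :
  sym_inf_rigid act (derived_adj_minus G e0) (derived_placement act p) <->
  rigid_on (predC1 e0) p.
Proof.
apply: sym_inf_rigidP => [x y [[e exy] n0]|e x y /= ee0 nl exy].
  by exists e => //=; apply: contra_notN n0 => /eqP <-.
split; first by exists e.
by move=> e0xy; move: ee0; rewrite (edge_orbit_uniq nl exy e0xy) eqxx.
Qed.

(** Minimality makes the rows of the rigidity matrix independent: for every edge some velocity
    stretches that edge alone. Subgraphs inherit independence, which gives sparsity; rigidity gives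
    the reverse inequality for the whole graph. *)
Lemma min_rigid_tight p : (0 < #|V|)%N -> rigid_on predT p ->
  (forall e, ~ rigid_on (predC1 e) p) -> tight G 2 2.
Proof.
move=> V0 rig mini.
have indep e : exists2 w, elongation p w e != 0 &
    forall f, f != e -> elongation p w f = 0.
  apply: contrapT => H; apply: (mini e) => w we; apply: rig => f _.
  have [->|fe] := eqVneq f e; last exact: we.
  by apply/eqP; apply: contrapT => /negP wn; apply: H; exists w.
have le1 := stretch_independent_count V0 indep.
have le2 : (2 * #|V| <= #|E| + 2)%N.
  by apply: stretch_rigid_count V0 _ => w w0; apply: rig => e _; apply: w0.
split; last lia.
move=> V' E' sub /card_gt0P[e0 e0E].
pose src' (e : {e | e \in E'}) : {x | x \in V'} :=
  exist _ (src G (val e)) (proj1 (andP (sub _ (valP e)))).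
pose dst' (e : {e | e \in E'}) : {x | x \in V'} :=
  exist _ (dst G (val e)) (proj2 (andP (sub _ (valP e)))).
have := @stretch_independent_count R 2 _ _ src' dst'
  (fun e => (kappa (edge_vector p (val e)))^T).
have cV : #|{: {x | x \in V'}}| = #|V'|.
  by rewrite card_sig; apply: eq_card => x; rewrite inE.
have cE : #|{: {e | e \in E'}}| = #|E'|.
  by rewrite card_sig; apply: eq_card => x; rewrite inE.
rewrite cV cE => H; suff : (#|E'| + 2 <= 2 * #|V'|)%N by lia.
apply: H.
  by apply/card_gt0P; exists (src G e0); have /andP[] := sub _ e0E.
move=> e; have [w we wf] := indep (val e).
by exists (fun x => w (val x)) => [//|f fe]; apply: wf.
Qed.

(** Without [e0] there remain [2 * #|V| - 3] edges, one fewer than rigidity demands at any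
    placement. *)
Lemma tight_rigid_min p : tight G 2 2 -> forall e, ~ rigid_on (predC1 e) p.
Proof.
move=> [sp szE] e0 rig.
have V0 : (0 < #|V|)%N by apply/card_gt0P; exists (src G e0).
have := @stretch_rigid_count R 2 V {e | e != e0} (fun e => src G (val e))
  (fun e => dst G (val e)) (fun e => (kappa (edge_vector p (val e)))^T) V0.
have cE : #|{: {e | e != e0}}| = #|E|.-1.
  by rewrite card_sig -(cardC1 e0); apply: eq_card => x; rewrite !inE.
rewrite cE => H; have : (0 < #|E|)%N by apply/card_gt0P; exists e0.
suff : (2 * #|V| <= #|E|.-1 + 2)%N by lia.
by apply: H => w w0; apply: rig => e ee0; exact: (w0 (exist _ e ee0)).
Qed.

End Frameworks.


(** * Diagonal coordinates and the maximum norm *)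

Section Diagonal.
Variable R : realFieldType.

Definition diag_coord (z : 'rV[R]_2) : R * R := (z 0 0 + z 0 1, z 0 0 - z 0 1).

Definition of_diag (z : R * R) : 'rV[R]_2 :=
  \row_i (if i == 0 then (z.1 + z.2) / 2 else (z.1 - z.2) / 2).

Lemma of_diagK : cancel of_diag diag_coord.
Proof. by case=> a b; rewrite /diag_coord !mxE /=; apply: pair_ext => /=; lra. Qed.

Lemma diag_coordB x y : diag_coord (x - y) = diag_coord x - diag_coord y.
Proof. by rewrite /diag_coord !mxE; apply: pair_ext => /=; ring. Qed.

Lemma diag_coordN x : diag_coord (- x) = - diag_coord x.
Proof. by rewrite /diag_coord !mxE; apply: pair_ext => /=; ring. Qed.

Lemma diag_coord_inj : injective diag_coord.
Proof.
move=> x y [e1 e2]; apply/rowP => i.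
have [->|->] : i = 0 \/ i = 1.
  by case: i => [[|[|]]] // h; [left|right]; apply: val_inj.
- lra.
lra.
Qed.

End Diagonal.

(** The product of the diagonal coordinates is the difference of the squares of the two entries, so
    its sign tells which entry is larger in absolute value. *)
Lemma kappa_diag_coord (R : realType) (s : bool) (z : 'rV[R]_2) :
  0 < (-1) ^+ s * ((diag_coord z).1 * (diag_coord z).2) ->
  kappa z = delta_mx 0 (if s then 1 else 0).
Proof.
rewrite /diag_coord /kappa /=; move: (z 0 0) (z 0 1) => a b.
have E : (a + b) * (a - b) = `|a| ^+ 2 - `|b| ^+ 2.
  by rewrite !real_normK ?num_real // mulrC -subr_sqr.
rewrite E; have := normr_ge0 a; have := normr_ge0 b.
move: `|a| `|b| => x y y0 x0; case: s; rewrite ?expr0 ?expr1 => h.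
  have xy : x < y by nra.
  by rewrite ltNge (ltW xy) xy.
have -> : y < x by nra.
by [].
Qed.

(** * A rigid placement for every tight gain graph *)

Section Existence.
Variables (R : realType) (w1 w2 : 'rV[R]_2).
Hypothesis hw : free [:: w1; w2].
Local Notation act := (lattice_act w1 w2).
Variables (V E : finType) (G : gain_graph (int * int)%type V E).

Definition edge_dart (e : E) : dart R V :=
  (src G e, dst G e, diag_coord (lattice w1 w2 (gain G e))).

Definition edge_darts : seq (dart R V) :=
  [seq edge_dart e | e <- enum E] ++ [seq rdart (edge_dart e) | e <- enum E].

Hypothesis tG : tight G 2 2.

Lemma tight_loopless e : src G e != dst G e.
Proof.
apply/eqP => e0; have := (proj1 tG) [set src G e] [set e].
rewrite !cards1 => /(_ _ isT) H; suff : (1 <= 2 * 1 - 2 :> int) by [].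
by apply: H => f; rewrite inE => /eqP ->; rewrite -e0 !inE eqxx.
Qed.

Lemma edge_dart_inj : injective edge_dart.
Proof.
move=> e f ef; apply: (@gain_parallel _ _ _ G).
- exact: (congr1 (fun d => d.1.1) ef).
- exact: (congr1 (fun d => d.1.2) ef).
by apply: (lattice_inj hw); apply/diag_coord_inj; exact: (congr1 snd ef).
Qed.

Lemma edge_darts_tight : tight_darts [set: V]%SET edge_darts.
Proof.
split.
- have rinj : injective (fun e => rdart (edge_dart e)).
    by apply: inj_comp edge_dart_inj; apply: can_inj (@rdartK _ _).
  rewrite cat_uniq (map_inj_uniq edge_dart_inj) (map_inj_uniq rinj) enum_uniq andbT /=.
  (* A dart equal to the reverse of another comes from antiparallel edges with opposite gains, hence
     from a single edge, which would be a loop. *)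
  apply/hasPn => _ /mapP[e _ ->]; apply/mapP => -[f _ ef].
  have e1 : dst G e = src G f by exact: (congr1 (fun d => d.1.1) ef).
  have e2 : src G e = dst G f by exact: (congr1 (fun d => d.1.2) ef).
  have fe : e = f.
    apply: (gain_antiparallel (tight_loopless e)) => //.
    apply: (lattice_inj hw); apply/diag_coord_inj.
    rewrite latticeN diag_coordN; have /= := congr1 snd ef.
    by rewrite /rdart /edge_dart /= => <-; rewrite opprK.
  by have := tight_loopless e; rewrite e1 fe eqxx.
- move=> d; rewrite !mem_cat => /orP[]/mapP[e eE ->].
    by apply/orP; right; apply: (map_f (fun e => rdart (edge_dart e))).
  by apply/orP; left; rewrite rdartK map_f.
- by move=> d _; rewrite /inside !inE.
(* Each edge induced on [T] contributes two darts, so the edge bound doubles. Sparsity says nothing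
   about an empty [ET], where [T0] suffices. *)
- move=> T T0; pose ET : {set E} := [set e | inside T (edge_dart e)].
  have cE : count (inside T) [seq edge_dart e | e <- enum E] = #|ET|.
    rewrite count_map -sum1_count big_enum_cond -sum1_card.
    by apply: eq_bigl => e; rewrite [RHS]inE.
  have cE' : count (inside T) [seq rdart (edge_dart e) | e <- enum E] = #|ET|.
    rewrite -cE !(count_map _ _ (enum E)).
    by apply: eq_count => e; rewrite /= /inside /= andbC.
  rewrite count_cat cE cE'; move: T0; rewrite -card_gt0.
  have [ET0|ET1] := posnP #|ET|; first by rewrite ET0; lia.
  have : subgraph G T ET by move=> e; rewrite inE.
  by move=> /(proj1 tG)/(_ ET1); lia.
rewrite size_cat !(size_map _ (enum E)) -cardT cardsT; have := proj2 tG.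
by move: #|E| #|V|; clear => a b; lia.
Qed.

(** Colour [false] constrains the first entry of the velocities and colour [true] the second;
    connectedness of each class makes that entry constant. End points of a bar differ because a zero
    bar vector has no colour. *)
Lemma exists_rigid_placement : (0 < #|V|)%N ->
  exists2 q : V -> 'rV[R]_2, rigid_on w1 w2 G predT q &
    well_placed (derived_adj G) (derived_placement act q).
Proof.
move=> V0; have T0 : [set: V]%SET != finset.set0 by rewrite -card_gt0 cardsT.
have [p [pD pS]] := tight_darts_bicoloured T0 edge_darts_tight.
pose q x := of_diag (p x).
have dE e : diag_coord (edge_vector w1 w2 G q e) = disp p (edge_dart e).
  by rewrite /edge_vector !diag_coordB !of_diagK.
have De e : edge_dart e \in edge_darts by rewrite mem_cat map_f ?mem_enum.
exists q => [w w0|x y [e exy] pxy].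
  have wE (i : 'I_2) x y : w x 0 i = w y 0 i.
    pose s := i != 0; have iE : i = if s then 1 else 0.
      by rewrite /s; case: i {s} => [[|[|]]] // h; apply: val_inj.
    apply: (pS s (fun x => w x 0 i)); rewrite ?inE // => d.
    have main e : coloured s p (edge_dart e) -> w (src G e) 0 i = w (dst G e) 0 i.
      rewrite /coloured -dE => /kappa_diag_coord ke.
      have := w0 e isT; rewrite /elongation /stretch ke -iE => h.
      apply/eqP; rewrite -subr_eq0; apply/eqP; rewrite -h mxE (bigD1 i) //=.
      rewrite big1 ?addr0; last first.
        by move=> j ji; rewrite !mxE (negbTE ji) andbF mulr0.
      by rewrite !mxE !eqxx mulr1.
    rewrite mem_cat => /orP[]/mapP[e _ ->] //=; first exact: main.
    by rewrite coloured_rdart => /main ->.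
  have [x0 _] := card_gt0P V0; exists (w x0) => x; apply/rowP => i; exact: wE.
have v0 : edge_vector w1 w2 G q e = 0.
  have [h|h] := edge_orbit_vector w1 w2 q exy.
    by rewrite -h pxy subrr.
  by apply/eqP; rewrite -oppr_eq0 -h pxy subrr.
have [s] := pD _ (De e).
by rewrite /coloured -dE v0 /diag_coord !mxE !addr0 !mul0r mulr0 ltxx.
Qed.

End Existence.

(** * Dimension of the motion space and the equivalence *)

Lemma has_dim_le_span (R : realType) (W : lmodType R) (S : set W) (n d : nat)
    (c : 'I_d -> W) : has_dim S n -> (n <= d)%N -> (forall i, S (c i)) ->
  (forall a : 'I_d -> R, \sum_i a i *: c i = 0 -> forall i, a i = 0) ->
  forall w, S w -> exists a : 'I_d -> R, w = \sum_i a i *: c i.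
Proof.
move=> [b [_ _ bS]] nd cS c_free w /bS [aw ->].
have [C cC] : exists C : 'M[R]_(d, n), forall i, c i = \sum_j C i j *: b j.
  have /choice [f fP] i := bS _ (cS i).
  by exists (\matrix_(i, j) f i j) => i; rewrite fP; apply: eq_bigr => j _; rewrite mxE.
have cE (r : 'rV[R]_d) : \sum_i r 0 i *: c i = \sum_j (r *m C) 0 j *: b j.
  transitivity (\sum_i \sum_j (r 0 i * C i j) *: b j).
    apply: eq_bigr => i _; rewrite cC scaler_sumr.
    by apply: eq_bigr => j _; rewrite scalerA.
  by rewrite exchange_big; apply: eq_bigr => j _; rewrite mxE scaler_suml.
have Cfree : row_free C.
  apply: inj_row_free => r rC; apply/rowP => i; rewrite mxE.
  apply: (c_free (fun i => r 0 i)); rewrite cE rC big1 // => j _.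
  by rewrite mxE scale0r.
(* The rank of [C] is [d], and [n <= d], so its rows span the whole coefficient space and the [c i]
   span all that the [b j] do. *)
have Cfull : row_full C.
  by rewrite /row_full eqn_leq rank_leq_col (eqP Cfree).
have /submxP[r rE] := submx_full (\row_j aw j) Cfull.
exists (fun i => r 0 i); rewrite cE -rE; apply: eq_bigr => j _; by rewrite mxE.
Qed.

Theorem theorem9p1 (R : realType) (w1 w2 : 'rV[R]_2)
    (hw : free [:: w1; w2])
    (V E : finType) (hV : (0 < #|V|)%N)
    (G : gain_graph (int * int)%type V E)
    (p : V -> 'rV[R]_2)
    (hp : well_placed (derived_adj G) (derived_placement (lattice_act w1 w2) p))
    (hreg : sym_regular (lattice_act w1 w2) (derived_adj G)
              (derived_placement (lattice_act w1 w2) p)) :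
  min_sym_inf_rigid (lattice_act w1 w2) G
    (derived_placement (lattice_act w1 w2) p) <->
  tight G 2 2.
Proof.
split=> [[/sym_inf_rigid_derived rig mini]|tG].
  by apply: min_rigid_tight rig _ => // e /sym_inf_rigid_derived_minus; apply: mini.
split; last first.
  by move=> e /sym_inf_rigid_derived_minus; apply: tight_rigid_min.
(* The constant motions in the two coordinate directions are symmetric motions of every
   placement. *)
pose c (i : 'I_2) : (int * int) * V -> 'rV[R]_2 := fun=> delta_mx 0 i.
have sumc (a : 'I_2 -> R) x : (\sum_i a i *: c i) x = \row_i a i.
  rewrite fct_sumE [RHS]row_sum_delta; apply: eq_bigr => i _.
  by rewrite mxE.
have cS q i : sym_motions (lattice_act w1 w2) (derived_adj G)
    (derived_placement (lattice_act w1 w2) q) (c i).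
  split=> [x y _|g x]; last by rewrite linear_part_lattice.
  by rewrite dotE subrr mul0mx mxE.
have [x0 _] := card_gt0P hV.
have c_free (a : 'I_2 -> R) : \sum_i a i *: c i = 0 -> forall i, a i = 0.
  move=> /(congr1 (fun u => u (0, x0))); rewrite sumc => /rowP + i => /(_ i).
  by rewrite !mxE.
have [n dimp minp] := hreg.
(* One rigid placement has a motion space of dimension 2, so regularity bounds that of [p] by 2, and
   the constants already fill it. *)
have [q rq wq] := exists_rigid_placement hw tG hV.
have n2 : (n <= 2)%N.
  apply: (minp (derived_placement (lattice_act w1 w2) q)) => //.
    move=> g x; rewrite -[RHS]/(q x.2 + lattice w1 w2 x.1 + lattice w1 w2 g).
    by rewrite derived_placementE latticeD (addrC (lattice w1 w2 g)) addrA.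
  exists c; split=> // u /(proj2 (sym_inf_rigid_derived w1 w2 G q) rq) [z uz].
  exists (fun i => z 0 i); apply: funext => x; rewrite sumc uz.
  by apply/rowP => i; rewrite mxE.
move=> u /(has_dim_le_span dimp n2 (cS p) c_free) [a ->].
by exists (\row_i a i) => x; exact: sumc.
Qed.
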